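(* Let $a\in\mathbb{A}$ with $a>5$, let $b\ne1$ be odd with $\gcd(a,b)=1$, and let $G=G_{a,b}$. The $8$-dimensional representation of $G$ on $\mathbb{R}^8$ has no (nonzero) quadratic equivariants, i.e. $P_G^2(\mathbb{R}^8,\mathbb{R}^8)=\{0\}$. The space $P_G^3(\mathbb{R}^8,\mathbb{R}^8)$ of cubic equivariants is $5$-dimensional, and a basis is given by the maps $E_1,\dots,E_5$ listed in the context. Furthermore, $E_1,\dots,E_5$ are equivariant with respect to the Lie group $\mathbf{G}_a$.
   Context: Let $\mathbb{A}$ be the set of all finite products $\prod_{i=1}^r a_i^{s_i}$ with $r\ge1$, $s_i\ge1$ and primes $a_i\equiv 1 \bmod 4$. For each $a\in\mathbb{A}$ fix (once and for all) an odd $\rho\in\{0,\dots,a-1\}$ with $\rho^2\equiv -1\bmod a$ (such $\rho$ exists). Let $\mathbf{r}(\psi)=\begin{pmatrix}\cos\psi&-\sin\psi\\ \sin\psi&\cos\psi\end{pmatrix}$ and $$c=\begin{pmatrix}\mathbf{r}(\pi/a)&0\\0&\mathbf{r}(\pi/a)\end{pmatrix},\quad d(\psi)=\begin{pmatrix}\mathbf{r}(-\psi)&0\\0&\mathbf{r}(\psi)\end{pmatrix},$$ $$q=\begin{pmatrix}0&0&1&0\\0&0&0&1\\-1&0&0&0\\0&-1&0&0\end{pmatrix},\quad s=\begin{pmatrix}0&0&-1&0\\0&0&0&1\\1&0&0&0\\0&-1&0&0\end{pmatrix}.$$ In $4\times4$ blocks define $$C=\begin{pmatrix}c&0\\0&c^\rho\end{pmatrix},\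 D(\psi)=\begin{pmatrix}d(\psi)&0\\0&d(\psi)\end{pmatrix},\ Q=\begin{pmatrix}q&0\\0&-q\end{pmatrix},\ S=\begin{pmatrix}s&0\\0&s\end{pmatrix},\ V=\begin{pmatrix}0&\mathbf{1}_4\\ s&0\end{pmatrix}.$$ For odd $b\ge3$ with $\gcd(a,b)=1$ let $G_{a,b}=\langle C,D(\pi/b),Q,S,V\rangle$, a finite subgroup of $\mathrm{O}(8)$, and let $\mathbf{G}_a=\langle C,Q,S,V,D(\psi)\mid \psi\in S^1\rangle$ with $S^1=\mathbb{R}/2\pi\mathbb{Z}$. $P_G^d(\mathbb{R}^8,\mathbb{R}^8)$ is the real vector space of homogeneous polynomial maps $P:\mathbb{R}^8\to\mathbb{R}^8$ of degree $d$ with $P(gx)=gP(x)$ for all $g\in G$, $x\in\mathbb{R}^8$. With $x=(x_1,\dots,x_8)$ and $n_1=x_1^2+x_2^2$, $n_2=x_3^2+x_4^2$, $n_3=x_5^2+x_6^2$, $n_4=x_7^2+x_8^2$: $$E_1(x)=(n_1x_1,n_1x_2,n_2x_3,n_2x_4,n_3x_5,n_3x_6,n_4x_7,n_4x_8)^T,$$ $$E_2(x)=(n_2x_1,n_2x_2,n_1x_3,n_1x_4,n_4x_5,n_4x_6,n_3x_7,n_3x_8)^T,$$ $$E_3(x)=(n_3x_1,n_3x_2,n_4x_3,n_4x_4,n_2x_5,n_2x_6,n_1x_7,n_1x_8)^T,$$ $$E_4(x)=(n_4x_1,n_4x_2,n_3x_3,n_3x_4,n_1x_5,n_1x_6,n_2x_7,n_2x_8)^T,$$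 $$E_5(x)=\begin{pmatrix}-x_3x_5x_7-x_3x_6x_8-x_4x_5x_8+x_4x_6x_7\\ x_3x_5x_8-x_3x_6x_7-x_4x_5x_7-x_4x_6x_8\\ -x_1x_5x_7-x_1x_6x_8+x_2x_5x_8-x_2x_6x_7\\ -x_1x_5x_8+x_1x_6x_7-x_2x_5x_7-x_2x_6x_8\\ x_1x_3x_7+x_1x_4x_8-x_2x_3x_8+x_2x_4x_7\\ x_1x_3x_8-x_1x_4x_7+x_2x_3x_7+x_2x_4x_8\\ x_1x_3x_5-x_1x_4x_6+x_2x_3x_6+x_2x_4x_5\\ x_1x_3x_6+x_1x_4x_5-x_2x_3x_5+x_2x_4x_6\end{pmatrix}.$$ *)

(* Defs.v *)
From HB Require Import structures.
From mathcomp Require Import all_boot all_order all_algebra.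
From mathcomp Require Import all_classical all_reals all_analysis.
(* The notations of [mpoly] clash with those of MathComp-Analysis. *)
From mathcomp Require Import -(notations) mpoly.
Set Implicit Arguments.
Unset Strict Implicit.
Unset Printing Implicit Defensive.
Import Order.TTheory GRing.Theory Num.Theory.
Local Open Scope classical_set_scope.
Local Open Scope ring_scope.

Definition in_bbA (a : nat) : Prop :=
  exists (r : nat) (p s : 'I_r -> nat),
    [/\ (1 <= r)%N,
        forall i, prime (p i) /\ p i = 1%N %[mod 4],
        forall i, (1 <= s i)%N
      & a = (\prod_(i < r) p i ^ s i)%N].

Section Matrices.
Variable R : realType.

Definition mx_of_rows (m n : nat) (rows : seq (seq R)) : 'M[R]_(m, n) :=
  \matrix_(i, j) nth 0 (nth [::] rows i) j.

Definition rot_mx (psi : R) : 'M[R]_2 :=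
  mx_of_rows 2 2 [:: [:: cos psi; - sin psi];
                     [:: sin psi;   cos psi]].

Definition c_mx (a : nat) : 'M[R]_4 :=
  block_mx (rot_mx (pi / a%:R)) 0 0 (rot_mx (pi / a%:R)).

Definition d_mx (psi : R) : 'M[R]_4 :=
  block_mx (rot_mx (- psi)) 0 0 (rot_mx psi).

Definition q_mx : 'M[R]_4 :=
  mx_of_rows 4 4 [:: [::  0;  0; 1; 0];
                     [::  0;  0; 0; 1];
                     [:: -1;  0; 0; 0];
                     [::  0; -1; 0; 0]].

Definition s_mx : 'M[R]_4 :=
  mx_of_rows 4 4 [:: [:: 0;  0; -1; 0];
                     [:: 0;  0;  0; 1];
                     [:: 1;  0;  0; 0];
                     [:: 0; -1;  0; 0]].

Definition C_mx (a rho : nat) : 'M[R]_8 :=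
  block_mx (c_mx a) 0 0 (c_mx a ^+ rho : 'M[R]_4).

Definition D_mx (psi : R) : 'M[R]_8 := block_mx (d_mx psi) 0 0 (d_mx psi).

Definition Q_mx : 'M[R]_8 := block_mx q_mx 0 0 (- q_mx).

Definition S_mx : 'M[R]_8 := block_mx s_mx 0 0 s_mx.

Definition V_mx : 'M[R]_8 := block_mx 0 (1%:M : 'M[R]_4) s_mx 0.

Definition is_subgroup (H : set 'M[R]_8) : Prop :=
  [/\ H `<=` [set M | M \in unitmx],
      H 1%:M,
      forall M N, H M -> H N -> H (M *m N)
    & forall M, H M -> H (invmx M)].

Definition generated (X : set 'M[R]_8) : set 'M[R]_8 := smallest is_subgroup X.

Definition G_ab (a rho b : nat) : set 'M[R]_8 :=
  generated [set C_mx a rho; D_mx (pi / b%:R); Q_mx; S_mx; V_mx].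

(* Letting [psi] range over all reals is the same as over R/2piZ, since
   [D_mx] is 2pi-periodic. *)
Definition bold_G (a rho : nat) : set 'M[R]_8 :=
  generated ([set C_mx a rho; Q_mx; S_mx; V_mx] `|` range D_mx).

End Matrices.

Arguments G_ab : clear implicits.
Arguments bold_G : clear implicits.

Section Equivariants.
Variable R : realType.

Definition homog_poly_map (d : nat) (P : 'cV[R]_8 -> 'cV[R]_8) : Prop :=
  exists p : 'I_8 -> mpoly 8 R,
    (forall i, p i \is ishomog1 d mdeg) /\
    (forall x i, P x i 0 = meval (fun j => x j 0) (p i)).

Definition equivariant (G : set 'M[R]_8) (P : 'cV[R]_8 -> 'cV[R]_8) : Prop :=
  forall g, G g -> forall x, P (g *m x) = g *m P x.

Definition PG (G : set 'M[R]_8) (d : nat) : set ('cV[R]_8 -> 'cV[R]_8) :=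
  [set P | homog_poly_map d P /\ equivariant G P].

Definition is_basis (V : lmodType R) (W : set V) (n : nat) (e : 'I_n -> V) :
    Prop :=
  [/\ forall i, W (e i),
      forall k : 'I_n -> R, \sum_(i < n) k i *: e i = 0 -> forall i, k i = 0
    & forall v, W v -> exists k : 'I_n -> R, v = \sum_(i < n) k i *: e i].

Definition has_dim (V : lmodType R) (W : set V) (n : nat) : Prop :=
  exists e : 'I_n -> V, is_basis W e.

Lemma PG_submod (G : set 'M[R]_8) (d : nat) :
  PG G d 0 /\ forall (k : R) P Q, PG G d P -> PG G d Q -> PG G d (k *: P + Q).
Proof.
split=> [|k P Q [[p [hp Pp]] eP] [[q [hq Qq]] eQ]].
  split; last by move=> g _ x; rewrite /= mulmx0.
  exists (fun=> 0); split=> [i|x i]; first exact: dhomog0.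
  by rewrite mxE meval0.
split; last first.
  move=> g Gg x; rewrite !fctE /= eP // eQ //.
  by rewrite mulmxDr scalemxAr.
exists (fun i => k *: p i + q i); split=> [i|x i].
  by apply: rpredD => //; apply: rpredZ.
by rewrite !fctE /= !mxE mevalD mevalZ Pp Qq.
Qed.

End Equivariants.

Section Cubics.
Variable R : realType.

(* [co x k] is the coordinate x_k, numbered from 1. *)
Definition co (x : 'cV[R]_8) (k : nat) : R := x (inord k.-1) 0.

Definition n1 (x : 'cV[R]_8) : R := co x 1 ^+ 2 + co x 2 ^+ 2.
Definition n2 (x : 'cV[R]_8) : R := co x 3 ^+ 2 + co x 4 ^+ 2.
Definition n3 (x : 'cV[R]_8) : R := co x 5 ^+ 2 + co x 6 ^+ 2.
Definition n4 (x : 'cV[R]_8) : R := co x 7 ^+ 2 + co x 8 ^+ 2.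

Definition vec8 (s : seq R) : 'cV[R]_8 := \col_i nth 0 s i.

Definition E1 (x : 'cV[R]_8) : 'cV[R]_8 :=
  vec8 [:: n1 x * co x 1; n1 x * co x 2; n2 x * co x 3; n2 x * co x 4;
           n3 x * co x 5; n3 x * co x 6; n4 x * co x 7; n4 x * co x 8].

Definition E2 (x : 'cV[R]_8) : 'cV[R]_8 :=
  vec8 [:: n2 x * co x 1; n2 x * co x 2; n1 x * co x 3; n1 x * co x 4;
           n4 x * co x 5; n4 x * co x 6; n3 x * co x 7; n3 x * co x 8].

Definition E3 (x : 'cV[R]_8) : 'cV[R]_8 :=
  vec8 [:: n3 x * co x 1; n3 x * co x 2; n4 x * co x 3; n4 x * co x 4;
           n2 x * co x 5; n2 x * co x 6; n1 x * co x 7; n1 x * co x 8].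

Definition E4 (x : 'cV[R]_8) : 'cV[R]_8 :=
  vec8 [:: n4 x * co x 1; n4 x * co x 2; n3 x * co x 3; n3 x * co x 4;
           n1 x * co x 5; n1 x * co x 6; n2 x * co x 7; n2 x * co x 8].

Definition E5 (x : 'cV[R]_8) : 'cV[R]_8 :=
  let x1 := co x 1 in let x2 := co x 2 in
  let x3 := co x 3 in let x4 := co x 4 in
  let x5 := co x 5 in let x6 := co x 6 in
  let x7 := co x 7 in let x8 := co x 8 in
  vec8 [:: - x3 * x5 * x7 - x3 * x6 * x8 - x4 * x5 * x8 + x4 * x6 * x7;
           x3 * x5 * x8 - x3 * x6 * x7 - x4 * x5 * x7 - x4 * x6 * x8;
           - x1 * x5 * x7 - x1 * x6 * x8 + x2 * x5 * x8 - x2 * x6 * x7;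
           - x1 * x5 * x8 + x1 * x6 * x7 - x2 * x5 * x7 - x2 * x6 * x8;
           x1 * x3 * x7 + x1 * x4 * x8 - x2 * x3 * x8 + x2 * x4 * x7;
           x1 * x3 * x8 - x1 * x4 * x7 + x2 * x3 * x7 + x2 * x4 * x8;
           x1 * x3 * x5 - x1 * x4 * x6 + x2 * x3 * x6 + x2 * x4 * x5;
           x1 * x3 * x6 + x1 * x4 * x5 - x2 * x3 * x5 + x2 * x4 * x6].

(* The family E_1, ..., E_5, indexed from 0. *)
Definition E_cubic (i : 'I_5) : 'cV[R]_8 -> 'cV[R]_8 :=
  nth E1 [:: E1; E2; E3; E4; E5] i.

End Cubics.

Arguments E_cubic : clear implicits.

(* Main.v *)
Require Import Defs.
From mathcomp Require Import all_boot all_order all_algebra.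
From mathcomp Require Import all_classical all_reals all_analysis.
From mathcomp Require Import -(notations) mpoly.
From mathcomp Require Import ring lra zify complex.
Import Order.TTheory GRing.Theory Num.Theory.
Local Open Scope classical_set_scope.
Local Open Scope ring_scope.
Set Implicit Arguments.
Unset Strict Implicit.
Unset Printing Implicit Defensive.
Local Open Scope complex_scope.

(** Read R^8 as C^4 through z1 = x1 + i x2, ..., z4 = x7 + i x8.  Then C and
    D(psi) are diagonal: C multiplies z1, z2 by e^(i pi/a) and z3, z4 by
    e^(i rho pi/a), while D(psi) multiplies z1, z3 by e^(-i psi) and z2, z4 by
    e^(i psi).  The elements Q, S, V permute the z's up to sign and complex
    conjugation.  In these coordinates each E_k is a sum of monomials in the
    z's and their conjugates, and equivariance under each generator is a ring
    identity ([E_cubic_C], ..., [E_cubic_V]); it extends to the generated group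
    because the invertible matrices commuting with a map form a subgroup
    ([equivariant_generated]).

    There are no quadratic equivariants because D(pi/b)^b = -1: such a map is
    both even and odd ([PG2_eq0]).

    Let P be a cubic equivariant.  Its complex component z1(P x) is a complex
    combination of cubic monomials in the z's and their conjugates
    ([homog_zc_span]).  C and D(pi/b) scale each monomial by a root of unity,
    and z1(P x) is an eigenvector of both, so averaging over the powers of C
    and of D(pi/b) discards every monomial with another eigenvalue
    ([eigen_filter]).  Let u be the number of factors z1, z2 minus the number
    of their conjugates, and w the same count for z3, z4.  A monomial that
    survives C satisfies u + rho w = 1 mod 2a; as rho^2 = -1 mod a, it follows
    that a divides (u-1)^2 + w^2, which is even and at most 16.  Since
    a = 1 mod 4 and a > 5 we have a >= 9, hence u = 1 and w = 0
    ([resonance_C]).  Surviving D(pi/b) then leaves exactly the monomials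
    z1 |z_j|^2 and z2 z3 conj(z4), which are, up to sign, the z1-components of
    E_1, ..., E_5 ([resonant_span]).

    So z1(P x) = sum_k c_k z1(E_k x) with complex c_k.  Equivariance under Q
    gives the same formula for z2, and equivariance under S gives it with
    conj(c_k) in place of c_k; the mean of the two has the real coefficients
    Re c_k.  An equivariant map is determined by its z2-component through Q
    and V ([equivariant_eq]), hence P = sum_k (Re c_k) E_k ([E_cubic_span]).
    Evaluation at five points gives linear independence ([E_cubic_free]). *)

(** * Complex coordinates and the action of the generators *)

Arguments conjc : simpl never.

(** The coordinates z1, z2, z3, z4 are the values at (h, l) = (false, false),
    (false, true), (true, false), (true, true): C acts through h and D through
    l, which makes the formulas below uniform in h and l. *)
Definition zc (R : realType) (h l : bool) (x : 'cV[R]_8) : R[i] :=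
  if h then if l then co x 7 +i* co x 8 else co x 5 +i* co x 6
  else if l then co x 3 +i* co x 4 else co x 1 +i* co x 2.

Definition cis (R : realType) (t : R) : R[i] := cos t +i* sin t.

Arguments zc : simpl never.
Arguments cis : simpl never.

Lemma inj_unitmx (F : fieldType) (n : nat) (A : 'M[F]_n) :
  (forall x : 'cV[F]_n, A *m x = 0 -> x = 0) -> A \in unitmx.
Proof.
move=> A_inj; rewrite -unitmx_tr -row_free_unit; apply: inj_row_free => v vA.
by apply: trmx_inj; rewrite trmx0; apply: A_inj; rewrite -[A]trmxK -trmx_mul vA trmx0.
Qed.

Section Coordinates.
Variable R : realType.
Implicit Types (x : 'cV[R]_8) (u : 'cV[R]_2) (t : R) (h l : bool).

Lemma cisD s t : cis (s + t) = cis s * cis t.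
Proof. by rewrite /cis cosD sinD addrC; simpc; congr (_ +i* _); ring. Qed.

Lemma cis0 : cis (0 : R) = 1.
Proof. by rewrite /cis cos0 sin0. Qed.

Lemma cisMn t n : cis (t *+ n) = cis t ^+ n.
Proof.
by elim: n => [|n IH]; rewrite ?mulr0n ?cis0 // mulrS cisD IH exprS.
Qed.

Lemma cisN t : cis (- t) = conjc (cis t).
Proof. by rewrite /cis cosN sinN. Qed.

Lemma cis_conjK t : cis t * conjc (cis t) = 1.
Proof. by rewrite -cisN -cisD subrr cis0. Qed.

Definition plane u : R[i] := u 0 0 +i* u 1 0.

(** The column vector assembled from its four planar parts, indexed as [zc];
    block products are computed on this form. *)
Definition quad (u : bool -> bool -> 'cV[R]_2) : 'cV[R]_8 :=
  col_mx (col_mx (u false false) (u false true) : 'cV[R]_4)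
         (col_mx (u true false) (u true true) : 'cV[R]_4).

Lemma ord8_lower (k : 'I_4) : inord k = lshift 4 k :> 'I_8.
Proof. by apply: val_inj; rewrite /= inordK //=; case: k => k /= /leq_trans ->. Qed.

Lemma ord8_upper (k : 'I_4) : inord (4 + k) = rshift 4 k :> 'I_8.
Proof. by apply: val_inj; rewrite /= inordK //= -[8%N]/(4 + 4)%N ltn_add2l. Qed.

Lemma zc_quad h l (u : bool -> bool -> 'cV[R]_2) : zc h l (quad u) = plane (u h l).
Proof.
have low (k : 'I_4) : co (quad u) k.+1 = col_mx (u false false) (u false true) k 0.
  by rewrite /co /= ord8_lower /quad (col_mxEu (col_mx (u false false) _ : 'cV[R]_4)).
have up (k : 'I_4) : co (quad u) (4 + k).+1 = col_mx (u true false) (u true true) k 0.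
  by rewrite /co /= ord8_upper /quad (col_mxEd (col_mx (u false false) _ : 'cV[R]_4)).
have E0 (v w : 'cV[R]_2) : col_mx v w (lshift 2 0) 0 = v 0 0 by rewrite col_mxEu.
have E1 (v w : 'cV[R]_2) : col_mx v w (lshift 2 1) 0 = v 1 0 by rewrite col_mxEu.
have E2 (v w : 'cV[R]_2) : col_mx v w (rshift 2 0) 0 = w 0 0 by rewrite col_mxEd.
have E3 (v w : 'cV[R]_2) : col_mx v w (rshift 2 1) 0 = w 1 0 by rewrite col_mxEd.
rewrite /zc /plane; case: h; case: l; congr (_ +i* _).
- by rewrite -(E2 (u true false)) -(up (rshift 2 (0 : 'I_2))).
- by rewrite -(E3 (u true false)) -(up (rshift 2 (1 : 'I_2))).
- by rewrite -(E0 _ (u true true)) -(up (lshift 2 (0 : 'I_2))).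
- by rewrite -(E1 _ (u true true)) -(up (lshift 2 (1 : 'I_2))).
- by rewrite -(E2 (u false false)) -(low (rshift 2 (0 : 'I_2))).
- by rewrite -(E3 (u false false)) -(low (rshift 2 (1 : 'I_2))).
- by rewrite -(E0 _ (u false true)) -(low (lshift 2 (0 : 'I_2))).
- by rewrite -(E1 _ (u false true)) -(low (lshift 2 (1 : 'I_2))).
Qed.

Lemma quadP x : exists u : bool -> bool -> 'cV[R]_2, x = quad u.
Proof.
pose y := x : 'cV_(4 + 4).
pose yu := usubmx y : 'cV_(2 + 2); pose yd := dsubmx y : 'cV_(2 + 2).
exists (fun h l => if h then if l then dsubmx yd else usubmx yd
                   else if l then dsubmx yu else usubmx yu).
by rewrite /quad /= !vsubmxK.
Qed.

Lemma zc_inj x y : (forall h l, zc h l x = zc h l y) -> x = y.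
Proof.
have [u ->] := quadP x; have [v ->] := quadP y => uv.
have {}uv h l : u h l = v h l.
  have := uv h l; rewrite !zc_quad => -[e0 e1].
  apply/colP => -[[|[|//]] i_lt].
    by move: e0; congr (_ = _); congr (_ _ _); exact: val_inj.
  by move: e1; congr (_ = _); congr (_ _ _); exact: val_inj.
by rewrite /quad !uv.
Qed.

Lemma plane_rot t u : plane (rot_mx t *m u) = cis t * plane u.
Proof.
rewrite /plane /cis; simpc; rewrite !mxE !big_ord_recl !big_ord0 !mxE /= !addr0.
have -> : lift ord0 ord0 = 1 :> 'I_2 by exact: val_inj.
by congr (_ +i* _); rewrite ?mulNr // addrC.
Qed.

Lemma rot_mxM s t : rot_mx s *m rot_mx t = rot_mx (s + t).
Proof.
apply/matrixP => i j; rewrite !mxE !big_ord_recl !big_ord0 !mxE /= cosD sinD.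
by case: i => [[|[|//]] ?]; case: j => [[|[|//]] ?] /=; ring.
Qed.

Lemma rot_mx0 : rot_mx 0 = 1%:M :> 'M[R]_2.
Proof.
apply/matrixP => i j; rewrite !mxE cos0 sin0 oppr0.
by case: i => [[|[|//]] ?]; case: j => [[|[|//]] ?].
Qed.

(** The common shape of C and D(psi). *)
Definition rot4 (t : bool -> bool -> R) : 'M[R]_8 :=
  block_mx (block_mx (rot_mx (t false false)) 0 0 (rot_mx (t false true)) : 'M[R]_4)
           0 0
           (block_mx (rot_mx (t true false)) 0 0 (rot_mx (t true true)) : 'M[R]_4).

Lemma mul_block8 (A B C D : 'M[R]_4) (u v : 'cV[R]_4) :
  (block_mx A B C D : 'M[R]_8) *m (col_mx u v : 'cV[R]_8) =
  col_mx (A *m u + B *m v) (C *m u + D *m v) :> 'cV[R]_8.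
Proof. exact: (@mul_block_col R _ _ _ _ _ A B C D u v). Qed.

Lemma mul_block4 (A B C D : 'M[R]_2) (u v : 'cV[R]_2) :
  (block_mx A B C D : 'M[R]_4) *m (col_mx u v : 'cV[R]_4) =
  col_mx (A *m u + B *m v) (C *m u + D *m v) :> 'cV[R]_4.
Proof. exact: (@mul_block_col R _ _ _ _ _ A B C D u v). Qed.

Lemma rot4_quad (t : bool -> bool -> R) (u : bool -> bool -> 'cV[R]_2) :
  rot4 t *m quad u = quad (fun h l => rot_mx (t h l) *m u h l).
Proof.
rewrite /rot4 /quad mul_block8.
by rewrite !mul0mx addr0 add0r !mul_block4 !mul0mx !addr0 !add0r.
Qed.

Lemma zc_rot4 h l (t : bool -> bool -> R) x :
  zc h l (rot4 t *m x) = cis (t h l) * zc h l x.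
Proof. by have [u ->] := quadP x; rewrite rot4_quad !zc_quad plane_rot. Qed.

Lemma c_mxX a n : c_mx R a ^+ n =
  block_mx (rot_mx (pi / a%:R *+ n)) 0 0 (rot_mx (pi / a%:R *+ n)) :> 'M[R]_4.
Proof.
elim: n => [|n IH]; first by rewrite expr0 mulr0n rot_mx0 -scalar_mx_block.
rewrite exprS IH -mulmxE /c_mx.
rewrite [LHS](@mulmx_block R 2 2 2 2 2 2 (rot_mx _) 0 0 (rot_mx _)).
by rewrite !mulmx0 !mul0mx !addr0 !add0r !rot_mxM -mulrS.
Qed.

Lemma zc_C a rho h l x : zc h l (C_mx R a rho *m x) =
  cis (pi / a%:R *+ (if h then rho else 1)) * zc h l x.
Proof.
rewrite -(zc_rot4 _ _ (fun h _ => pi / a%:R *+ (if h then rho else 1))).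
by rewrite /C_mx c_mxX.
Qed.

Lemma zc_D t h l x : zc h l (D_mx t *m x) =
  cis (if l then t else - t) * zc h l x.
Proof. by rewrite -(zc_rot4 _ _ (fun _ l => if l then t else - t)). Qed.

(** The matrix of complex conjugation on a plane, out of which s is built. *)
Definition reflect_mx : 'M[R]_2 := mx_of_rows 2 2 [:: [:: 1; 0]; [:: 0; -1]].

Lemma plane_reflect u : plane (reflect_mx *m u) = conjc (plane u).
Proof.
rewrite /plane /= !mxE !big_ord_recl !big_ord0 !mxE /=.
have -> : lift ord0 ord0 = 1 :> 'I_2 by exact: val_inj.
by congr (_ +i* _); ring.
Qed.

Lemma planeN u : plane (- u) = - plane u.
Proof. by rewrite /plane !mxE. Qed.

Lemma q_mx_block : q_mx R = block_mx 0 1%:M (- 1%:M) 0 :> 'M[R]_(2 + 2).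
Proof.
rewrite -[LHS](@submxK _ 2 2 2 2); congr block_mx; apply/matrixP => i j;
  rewrite !mxE; case: i => [[|[|//]] ?]; case: j => [[|[|//]] ?] //=;
  by rewrite ?oppr0.
Qed.

Lemma s_mx_block : s_mx R = block_mx 0 (- reflect_mx) reflect_mx 0 :> 'M[R]_(2 + 2).
Proof.
rewrite -[LHS](@submxK _ 2 2 2 2); congr block_mx; apply/matrixP => i j;
  rewrite !mxE; case: i => [[|[|//]] ?]; case: j => [[|[|//]] ?] //=;
  by rewrite ?oppr0 ?opprK.
Qed.

Lemma q_mx_col (u v : 'cV[R]_2) : q_mx R *m (col_mx u v : 'cV[R]_4) = col_mx v (- u).
Proof.
rewrite q_mx_block mul_block4.
by rewrite !mul0mx mul1mx mulNmx mul1mx addr0 add0r.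
Qed.

Lemma s_mx_col (u v : 'cV[R]_2) : s_mx R *m (col_mx u v : 'cV[R]_4) =
  col_mx (- (reflect_mx *m v)) (reflect_mx *m u).
Proof.
by rewrite s_mx_block mul_block4 !mul0mx mulNmx addr0 add0r.
Qed.

Lemma Q_quad (u : bool -> bool -> 'cV[R]_2) : Q_mx R *m quad u =
  quad (fun h l => if h (+) l then - u h (~~ l) else u h (~~ l)).
Proof.
rewrite /Q_mx /quad mul_block8 !mul0mx addr0 add0r mulNmx.
by rewrite !q_mx_col /= (opp_col_mx (u true true)) opprK.
Qed.

Lemma S_quad (u : bool -> bool -> 'cV[R]_2) : S_mx R *m quad u =
  quad (fun h l => let w := reflect_mx *m u h (~~ l) in if l then w else - w).
Proof.
by rewrite /S_mx /quad mul_block8 !mul0mx addr0 add0r !s_mx_col.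
Qed.

Lemma V_quad (u : bool -> bool -> 'cV[R]_2) : V_mx R *m quad u =
  quad (fun h l => if h then
    let w := reflect_mx *m u false (~~ l) in if l then w else - w
  else u true l).
Proof.
rewrite /V_mx /quad mul_block8 !mul0mx addr0 add0r mul1mx.
by rewrite s_mx_col.
Qed.

Lemma zc_Q h l x : zc h l (Q_mx R *m x) = (-1) ^+ (h (+) l) * zc h (~~ l) x.
Proof.
have [u ->] := quadP x; rewrite Q_quad !zc_quad.
by case: ifP; rewrite ?planeN ?expr0 ?expr1 ?mul1r ?mulN1r.
Qed.

Lemma zc_S h l x : zc h l (S_mx R *m x) = (-1) ^+ (~~ l) * conjc (zc h (~~ l) x).
Proof.
have [u ->] := quadP x; rewrite S_quad !zc_quad.
by case: l; rewrite /= ?planeN plane_reflect ?expr0 ?expr1 ?mul1r ?mulN1r.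
Qed.

Lemma zc_V h l x : zc h l (V_mx R *m x) =
  if h then (-1) ^+ (~~ l) * conjc (zc false (~~ l) x) else zc true l x.
Proof.
have [u ->] := quadP x; rewrite V_quad !zc_quad.
case: h => //; case: l; rewrite /= ?planeN plane_reflect ?expr0 ?expr1;
  by rewrite ?mul1r ?mulN1r.
Qed.

(** * The five cubic maps in complex coordinates *)

Lemma co_vec8 (s : seq R) k : (k < 8)%N -> co (vec8 s) k.+1 = s`_k.
Proof. by move=> k_lt; rewrite /co mxE /= inordK. Qed.

Definition sqnorm h l x : R[i] := zc h l x * conjc (zc h l x).

Lemma zc_E1 h l x : zc h l (E1 x) = sqnorm h l x * zc h l x.
Proof.
rewrite /sqnorm /zc /E1 !co_vec8 //= /n1 /n2 /n3 /n4.
by case: h; case: l; rewrite /conjc; simpc; congr (_ +i* _); ring.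
Qed.

Lemma zc_E2 h l x : zc h l (E2 x) = sqnorm h (~~ l) x * zc h l x.
Proof.
rewrite /sqnorm /zc /E2 !co_vec8 //= /n1 /n2 /n3 /n4.
by case: h; case: l; rewrite /conjc; simpc; congr (_ +i* _); ring.
Qed.

Lemma zc_E3 h l x : zc h l (E3 x) = sqnorm (~~ h) (h (+) l) x * zc h l x.
Proof.
rewrite /sqnorm /zc /E3 !co_vec8 //= /n1 /n2 /n3 /n4.
by case: h; case: l; rewrite /conjc; simpc; congr (_ +i* _); ring.
Qed.

Lemma zc_E4 h l x : zc h l (E4 x) = sqnorm (~~ h) (~~ (h (+) l)) x * zc h l x.
Proof.
rewrite /sqnorm /zc /E4 !co_vec8 //= /n1 /n2 /n3 /n4.
by case: h; case: l; rewrite /conjc; simpc; congr (_ +i* _); ring.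
Qed.

Lemma zc_E5 h l x : zc h l (E5 x) =
  if h then zc false l x * conjc (zc false (~~ l) x) * zc true (~~ l) x
  else - (zc false (~~ l) x * zc true l x * conjc (zc true (~~ l) x)).
Proof.
rewrite /zc /E5 !co_vec8 //=.
by case: h; case: l; rewrite /conjc; simpc; congr (_ +i* _); ring.
Qed.

(** * Equivariance of the five cubic maps *)

Lemma sqnorm_C a rho h l x : sqnorm h l (C_mx R a rho *m x) = sqnorm h l x.
Proof.
rewrite /sqnorm zc_C rmorphM /= mulrACA cis_conjK mul1r //.
Qed.

Lemma sqnorm_D t h l x : sqnorm h l (D_mx t *m x) = sqnorm h l x.
Proof. by rewrite /sqnorm zc_D rmorphM /= mulrACA cis_conjK mul1r. Qed.

Lemma sign_conjc (b : bool) : conjc ((-1) ^+ b : R[i]) = (-1) ^+ b.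
Proof. by rewrite rmorphXn rmorphN rmorph1. Qed.

Lemma sqnorm_Q h l x : sqnorm h l (Q_mx R *m x) = sqnorm h (~~ l) x.
Proof.
by rewrite /sqnorm zc_Q rmorphM /= sign_conjc mulrACA -expr2 sqrr_sign mul1r.
Qed.

Lemma sqnorm_S h l x : sqnorm h l (S_mx R *m x) = sqnorm h (~~ l) x.
Proof.
rewrite /sqnorm zc_S rmorphM /= sign_conjc conjcK mulrACA -expr2 sqrr_sign.
by rewrite mul1r mulrC.
Qed.

Lemma sqnorm_V h l x : sqnorm h l (V_mx R *m x) = sqnorm (~~ h) (h (+) l) x.
Proof.
rewrite /sqnorm zc_V; case: h => //=.
rewrite rmorphM /= sign_conjc conjcK mulrACA -expr2 sqrr_sign.
by rewrite mul1r mulrC.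
Qed.

Lemma conjc_sqnorm h l x : conjc (sqnorm h l x) = sqnorm h l x.
Proof. by rewrite /sqnorm rmorphM /= conjcK mulrC. Qed.

Lemma conjc_sqnormM h l x z : conjc (sqnorm h l x * z) = sqnorm h l x * conjc z.
Proof. by rewrite rmorphM /= conjc_sqnorm. Qed.

(** Case analysis on the index that keeps the generic shape of the goal, so that
    the five maps can be treated by one script. *)
Lemma E_cubic_ind (A : ('cV[R]_8 -> 'cV[R]_8) -> Prop) :
  A (@E1 R) -> A (@E2 R) -> A (@E3 R) -> A (@E4 R) -> A (@E5 R) ->
  forall i, A (E_cubic R i).
Proof. by move=> ? ? ? ? ?; case=> [[|[|[|[|[|//]]]]] ?]. Qed.

Lemma E_cubic_C a rho i x :
  E_cubic R i (C_mx R a rho *m x) = C_mx R a rho *m E_cubic R i x.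
Proof.
apply: (E_cubic_ind (A := fun E => E (C_mx R a rho *m x) = C_mx R a rho *m E x)) i;
  apply: zc_inj => h l.
1-4: by rewrite zc_C ?(zc_E1, zc_E2, zc_E3, zc_E4) sqnorm_C zc_C mulrCA.
rewrite zc_C !zc_E5 !zc_C !rmorphM /=.
case: h => /=; rewrite -[RHS]mul1r.
  by rewrite -(cis_conjK (pi / a%:R *+ 1)); ring.
by rewrite -(cis_conjK (pi / a%:R *+ rho)); ring.
Qed.

Lemma E_cubic_D t i x : E_cubic R i (D_mx t *m x) = D_mx t *m E_cubic R i x.
Proof.
apply: (E_cubic_ind (A := fun E => E (D_mx t *m x) = D_mx t *m E x)) i;
  apply: zc_inj => h l.
1-4: by rewrite zc_D ?(zc_E1, zc_E2, zc_E3, zc_E4) sqnorm_D zc_D mulrCA.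
rewrite zc_D !zc_E5 !zc_D !rmorphM /=.
by rewrite -[RHS]mul1r -(cis_conjK t); case: h; case: l; rewrite /= !cisN ?conjcK; ring.
Qed.

Lemma E_cubic_Q i x : E_cubic R i (Q_mx R *m x) = Q_mx R *m E_cubic R i x.
Proof.
apply: (E_cubic_ind (A := fun E => E (Q_mx R *m x) = Q_mx R *m E x)) i;
  apply: zc_inj => h l.
1-4: rewrite zc_Q ?(zc_E1, zc_E2, zc_E3, zc_E4) sqnorm_Q zc_Q mulrCA;
  by case: h; case: l.
rewrite zc_Q !zc_E5 !zc_Q !rmorphM /= !sign_conjc negbK.
by case: h; case: l; rewrite /= ?expr0 ?expr1; ring.
Qed.

Lemma E_cubic_S i x : E_cubic R i (S_mx R *m x) = S_mx R *m E_cubic R i x.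
Proof.
apply: (E_cubic_ind (A := fun E => E (S_mx R *m x) = S_mx R *m E x)) i;
  apply: zc_inj => h l.
1-4: rewrite zc_S ?(zc_E1, zc_E2, zc_E3, zc_E4) conjc_sqnormM;
  by rewrite sqnorm_S zc_S mulrCA; case: h; case: l.
rewrite zc_S !zc_E5 !zc_S.
by case: h; case: l; rewrite /= ?rmorphN ?rmorphM /= ?sign_conjc ?conjcK /=
  ?expr0 ?expr1; ring.
Qed.

Lemma E_cubic_V i x : E_cubic R i (V_mx R *m x) = V_mx R *m E_cubic R i x.
Proof.
apply: (E_cubic_ind (A := fun E => E (V_mx R *m x) = V_mx R *m E x)) i;
  apply: zc_inj => h l.
1-4: rewrite zc_V !(zc_E1, zc_E2, zc_E3, zc_E4) sqnorm_V zc_V;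
  by case: h; case: l; rewrite //= conjc_sqnormM mulrCA.
rewrite zc_V !zc_E5 !zc_V.
by case: h; case: l; rewrite /= ?rmorphN ?rmorphM /= ?sign_conjc ?conjcK /=
  ?expr0 ?expr1; ring.
Qed.

Lemma zc0 h l : zc h l (0 : 'cV[R]_8) = 0.
Proof. by rewrite /zc /co !mxE; case: h; case: l. Qed.

Lemma zcD h l x y : zc h l (x + y) = zc h l x + zc h l y.
Proof. by rewrite /zc /co !mxE; case: h; case: l. Qed.

Lemma zcZ h l k x : zc h l (k *: x) = k%:C * zc h l x.
Proof. by rewrite /zc /co !mxE; case: h; case: l; simpc. Qed.

Lemma cis_neq0 t : cis t != 0.
Proof.
by apply/eqP => e0; have := cis_conjK t; rewrite e0 mul0r => /esym/eqP; rewrite oner_eq0.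
Qed.

(** Each generator acts on the z's by nonzero scalars, conjugation and a
    permutation, so its kernel is trivial. *)
Lemma generator_unit a rho g :
  ([set C_mx R a rho; Q_mx R; S_mx R; V_mx R] `|` range (@D_mx R)) g -> g \in unitmx.
Proof.
move=> gX; apply: inj_unitmx => x gx0.
have {gx0} : forall h l, zc h l (g *m x) = 0 by move=> h l; rewrite gx0 zc0.
have ciskill t (z : R[i]) : cis t * z = 0 -> z = 0.
  by move/eqP; rewrite mulf_eq0 (negPf (cis_neq0 t)) => /eqP.
have signkill (b : bool) (z : R[i]) : (-1) ^+ b * z = 0 -> z = 0.
  by move/eqP; rewrite mulf_eq0 signr_eq0 => /eqP.
have conjkill (z : R[i]) : conjc z = 0 -> z = 0.
  by move/eqP; rewrite conjc_eq0 => /eqP.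
case: gX => [[[[->|->]|->]|->]|[t _ <-]] gz; apply: zc_inj => h l; rewrite zc0.
- by have := gz h l; rewrite zc_C => /ciskill.
- by have := gz h (~~ l); rewrite zc_Q negbK => /signkill.
- by have := gz h (~~ l); rewrite zc_S negbK => /signkill/conjkill.
- case: h; first by have := gz false l; rewrite zc_V.
  by have := gz true (~~ l); rewrite zc_V negbK => /signkill/conjkill.
- by have := gz h l; rewrite zc_D => /ciskill.
Qed.

(** The invertible matrices that commute with P form a subgroup, which contains
    the generated one as soon as it contains the generators. *)
Lemma equivariant_generated (X : set 'M[R]_8) (P : 'cV[R]_8 -> 'cV[R]_8) :
  (forall g, X g -> g \in unitmx) ->
  (forall g, X g -> forall x, P (g *m x) = g *m P x) ->
  equivariant (generated X) P.
Proof.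
move=> Xunit Xeq g Gg.
pose H := [set M : 'M[R]_8 | M \in unitmx /\ forall x, P (M *m x) = M *m P x].
suff: H g by case.
apply: Gg; split=> [|M XM]; last by split; [exact: Xunit|exact: Xeq].
split=> [M []//||M N [uM eM] [uN eN]|M [uM eM]].
- by split=> [|x]; rewrite ?unitmx1 // !mul1mx.
- by split=> [|x]; rewrite ?unitmx_mul ?uM // -!mulmxA eM eN.
- split=> [|x]; first by rewrite unitmx_inv.
  by rewrite -[LHS](mulKmx uM) -eM mulKVmx.
Qed.

Lemma generated_sub (X : set 'M[R]_8) g : X g -> generated X g.
Proof. by move=> Xg H [_]; exact. Qed.

Lemma generated_mono (X Y : set 'M[R]_8) : X `<=` Y -> generated X `<=` generated Y.
Proof. by move=> XY g Gg H [Hsub YH]; apply: Gg; split=> // M /XY/YH. Qed.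

Lemma E_cubic_equivariant a rho i : equivariant (bold_G R a rho) (E_cubic R i).
Proof.
apply: equivariant_generated; first exact: generator_unit.
move=> g [[[[]|]|]|[t _ <-]]; try move=> -> .
- exact: E_cubic_C.
- exact: E_cubic_Q.
- exact: E_cubic_S.
- exact: E_cubic_V.
- exact: E_cubic_D.
Qed.

Lemma G_ab_sub_bold a rho b : G_ab R a rho b `<=` bold_G R a rho.
Proof.
apply: generated_mono => g [[[[]|]|]|] ->; try by left; rewrite /=; tauto.
by right; exists (pi / b%:R).
Qed.

(** * Homogeneity of the five cubic maps *)

Definition is_form (d : nat) (f : 'cV[R]_8 -> R) : Prop :=
  exists p : mpoly 8 R, p \is ishomog1 d mdeg /\ forall x, f x = meval (fun j => x j 0) p.

Lemma is_form_ext d f g : is_form d f -> (forall x, g x = f x) -> is_form d g.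
Proof. by move=> [p [hp fp]] gf; exists p; split=> // x; rewrite gf. Qed.

Lemma is_formD d f g : is_form d f -> is_form d g -> is_form d (fun x => f x + g x).
Proof.
move=> [p [hp fp]] [q [hq gq]]; exists (p + q); split; first exact: rpredD.
by move=> x; rewrite mevalD fp gq.
Qed.

Lemma is_formN d f : is_form d f -> is_form d (fun x => - f x).
Proof.
move=> [p [hp fp]]; exists (- p); split; first by rewrite rpredN.
by move=> x; rewrite mevalN fp.
Qed.

Lemma is_formM d e f g : is_form d f -> is_form e g ->
  is_form (d + e) (fun x => f x * g x).
Proof.
move=> [p [hp fp]] [q [hq gq]]; exists (p * q); split; first exact: dhomogM.
by move=> x; rewrite mevalM fp gq.
Qed.

Lemma is_form_co k : is_form 1 (fun x => co x k).
Proof.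
exists (mpolyX _ (mnm1 (inord k.-1))); split.
  by rewrite dhomogX; apply/eqP; exact: mdeg1.
by move=> x; rewrite mevalXU.
Qed.

Lemma E_cubic_homog i : homog_poly_map 3 (E_cubic R i).
Proof.
suff E_form (j : 'I_8) : is_form 3 (fun x => E_cubic R i x j 0).
  by have [p pP] := choice E_form; exists p; split=> [j|x j]; case: (pP j).
move: i; apply: (E_cubic_ind (A := fun E => is_form 3 (fun x => E x j 0)));
  case: j => [[|[|[|[|[|[|[|[|//]]]]]]]] ?];
  (apply: is_form_ext => [|x]; last by rewrite mxE /= ?/n1 ?/n2 ?/n3 ?/n4 ?expr2);
  repeat first [apply: is_formD | apply: is_formN | exact: is_form_co
    | apply: (is_formM (d := 2) (e := 1)) | apply: (is_formM (d := 1) (e := 1))].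
Qed.

End Coordinates.

(** * Spans of functions and eigenvector filtering *)

Section ComplexSpan.
Variables (K : numFieldType) (X : Type).

Definition cspan (T : finType) (f : T -> X -> K) (F : X -> K) : Prop :=
  exists c : T -> K, forall x, F x = \sum_t c t * f t x.

Lemma cspan_ext (T : finType) (f : T -> X -> K) F G :
  cspan f F -> (forall x, G x = F x) -> cspan f G.
Proof. by move=> [c Fc] GF; exists c => x; rewrite GF. Qed.

Lemma cspan_gen (T : finType) (f : T -> X -> K) t : cspan f (f t).
Proof.
exists (fun s => (s == t)%:R) => x.
rewrite (bigD1 t) //= eqxx mul1r big1 ?addr0 // => s /negPf ->.
by rewrite mul0r.
Qed.

Lemma cspan0 (T : finType) (f : T -> X -> K) : cspan f (fun=> 0).
Proof. by exists (fun=> 0) => x; rewrite big1 // => t _; rewrite mul0r. Qed.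

Lemma cspanD (T : finType) (f : T -> X -> K) F G :
  cspan f F -> cspan f G -> cspan f (fun x => F x + G x).
Proof.
move=> [c Fc] [d Gd]; exists (fun t => c t + d t) => x.
by rewrite Fc Gd -big_split /=; apply: eq_bigr => t _; rewrite mulrDl.
Qed.

Lemma cspanZ (T : finType) (f : T -> X -> K) k F :
  cspan f F -> cspan f (fun x => k * F x).
Proof.
move=> [c Fc]; exists (fun t => k * c t) => x.
by rewrite Fc mulr_sumr; apply: eq_bigr => t _; rewrite mulrA.
Qed.

Lemma cspan_sum (T : finType) (f : T -> X -> K) (J : Type) (r : seq J)
    (A : pred J) (F : J -> X -> K) :
  (forall j, A j -> cspan f (F j)) -> cspan f (fun x => \sum_(j <- r | A j) F j x).
Proof.
move=> fF; elim: r => [|j r IH].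
  by apply: cspan_ext (cspan0 f) _ => x; rewrite big_nil.
case: (boolP (A j)) => Aj.
  by apply: cspan_ext (cspanD (fF j Aj) IH) _ => x; rewrite big_cons Aj.
by apply: cspan_ext IH _ => x; rewrite big_cons (negPf Aj).
Qed.

Lemma cspanM (S T : finType) (f : S -> X -> K) (g : T -> X -> K) F G :
  cspan f F -> cspan g G ->
  cspan (fun st x => f st.1 x * g st.2 x) (fun x => F x * G x).
Proof.
move=> [c Fc] [d Gd]; exists (fun st => c st.1 * d st.2) => x.
rewrite Fc Gd big_distrlr /= (pair_bigA _ (fun i j => c i * f i x * (d j * g j x))) /=.
by apply: eq_bigr => st _; rewrite mulrACA.
Qed.

(** An eigenvector written as a sum of eigenvectors only needs those with the
    same eigenvalue: the operator n^-1 sum_(k < n) mu^-k g^k fixes F and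
    multiplies f t by the mean of the powers of lam t / mu, an n-th root of
    unity, so this mean is 1 or 0. *)
Lemma eigen_filter (T : finType) (A : pred T) (g : X -> X) (f : T -> X -> K)
    (lam c : T -> K) (F : X -> K) (mu : K) (n : nat) :
  (0 < n)%N -> mu != 0 -> (forall t, lam t ^+ n = mu ^+ n) ->
  (forall t x, f t (g x) = lam t * f t x) ->
  (forall x, F (g x) = mu * F x) ->
  (forall x, F x = \sum_(t | A t) c t * f t x) ->
  forall x, F x = \sum_(t | A t && (lam t == mu)) c t * f t x.
Proof.
move=> n_gt0 mu0 lamn fg Fg Fc x.
have n0 : n%:R != 0 :> K by rewrite pnatr_eq0 -lt0n.
have iterF k : F (iter k g x) = mu ^+ k * F x.
  by elim: k => [|k IH]; rewrite ?mul1r //= Fg IH exprS mulrA.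
have iterf k t : f t (iter k g x) = lam t ^+ k * f t x.
  by elim: k => [|k IH]; rewrite ?mul1r //= fg IH exprS mulrA.
have geom t : \sum_(k < n) (lam t / mu) ^+ k = if lam t == mu then n%:R else 0.
  case: eqVneq => [->|lam_mu].
    rewrite divff // (eq_bigr (fun=> 1)) => [|k _]; last by rewrite expr1n.
    by rewrite sumr_const card_ord.
  have /eqP := subrX1 (lam t / mu) n.
  rewrite expr_div_n lamn divff ?expf_neq0 // subrr eq_sym mulf_eq0.
  by rewrite subr_eq0 -(inj_eq (mulIf mu0)) mul1r divfK // (negPf lam_mu) => /eqP.
apply: (mulfI n0).
transitivity (\sum_(k < n) mu ^- k * F (iter k g x)).
  rewrite (eq_bigr (fun=> F x)) => [|k _]; last by rewrite iterF mulKf ?expf_neq0.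
  by rewrite sumr_const card_ord mulr_natl.
rewrite (eq_bigr (fun k : 'I_n => \sum_(t | A t) c t * f t x * (lam t / mu) ^+ k)).
  rewrite exchange_big /= mulr_sumr big_mkcondr /=; apply: eq_bigr => t _.
  by rewrite -mulr_sumr geom; case: ifP; rewrite ?mulr0 // mulrC.
move=> k _; rewrite Fc mulr_sumr; apply: eq_bigr => t _.
by rewrite iterf expr_div_n; ring.
Qed.

End ComplexSpan.

(** * Arithmetic of the resonances *)

Section Arithmetic.

Lemma in_bbA_mod4 a : in_bbA a -> (a %% 4 = 1)%N.
Proof.
move=> [r [p [s [_ p_mod _ ->]]]].
apply: (big_ind (fun n => n %% 4 = 1)%N) => // [m n m1 n1|i _].
  by rewrite -modnMm m1 n1.
by have [_ pi1] := p_mod i; rewrite -modnXm pi1 modnXm exp1n.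
Qed.

(** In the ring of integers mod a, u - 1 = - rho w, and squaring gives that a
    divides N = (u - 1)^2 + w^2.  The bound on |u| + |w| gives N <= 16, and the
    parity of u + w makes N even.  As a is odd and at least 9, the only
    multiple of a of this kind is 0. *)
Lemma resonance_C (a rho : nat) (u w : int) :
  (a %% 4 = 1)%N -> (5 < a)%N -> (rho%:Z ^+ 2 = -1 %[mod a%:Z])%Z ->
  (absz u + absz w <= 3)%N -> odd (absz u + absz w) ->
  (a%:Z %| u + rho%:Z * w - 1)%Z -> u = 1 /\ w = 0.
Proof.
move=> a_mod a_gt rho2 uw_le uw_odd /dvdzP [k kE].
have /dvdzP [j jE] : (a%:Z %| rho%:Z ^+ 2 - -1)%Z by rewrite -eqz_mod_dvd; apply/eqP.
have N : (u - 1) ^+ 2 + w ^+ 2 = a%:Z * (k * (u - 1 - rho%:Z * w) + j * w ^+ 2).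
  transitivity ((u + rho%:Z * w - 1) * (u - 1 - rho%:Z * w)
                + (rho%:Z ^+ 2 - -1) * w ^+ 2); first by ring.
  by rewrite kE jE; ring.
move: (k * _ + _) N => n; rewrite !expr2 => N.
have n_cases : n = 0 \/ n = 1 \/ n <= -1 \/ n >= 2 by lia.
have a_ge : 9 <= a%:Z by lia.
(* N = a n with a >= 9; n = 1 is kept apart as it is excluded by parity. *)
have {n_cases N} N_cases : let N := (u - 1) * (u - 1) + w * w in
    N = 0 \/ N = a \/ N < 0 \/ 18 <= N.
  move=> /=; rewrite N; case: n_cases => [->|[->|[n_neg|n_ge2]]].
  - by left; rewrite mulr0.
  - by right; left; rewrite mulr1.
  - by right; right; left; rewrite pmulr_rlt0; lia.
  - by right; right; right; apply: le_trans (ler_pM _ _ a_ge n_ge2).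
have u_cases : u = -3 \/ u = -2 \/ u = -1 \/ u = 0 \/ u = 1 \/ u = 2 \/ u = 3
  by clear -uw_le; lia.
have w_cases : w = -3 \/ w = -2 \/ w = -1 \/ w = 0 \/ w = 1 \/ w = 2 \/ w = 3
  by clear -uw_le; lia.
move: N_cases uw_le uw_odd; clear -u_cases w_cases a_mod a_gt.
by case: u_cases => [->|[->|[->|[->|[->|[->|->]]]]]];
  case: w_cases => [->|[->|[->|[->|[->|[->|->]]]]]] => /= N_cases uw_le uw_odd;
  lia.
Qed.

(** d + 1 is even and lies between -2 and 4, while 2b >= 6. *)
Lemma resonance_D (b : nat) (d : int) :
  (3 <= b)%N -> (absz d <= 3)%N -> odd (absz d) -> (2 * b%:Z %| d + 1)%Z -> d = -1.
Proof.
move=> b3 d3 d_odd /dvdzP [k kE].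
have k_cases : k = 0 \/ k <= -1 \/ k >= 1 by lia.
have d_bd : -3 <= d <= 3 by lia.
case: k_cases => [k0|[kn|kp]]; [lia|nia|nia].
Qed.

End Arithmetic.

(** * Cubic polynomials as combinations of monomials in z and its conjugate *)

Section Tensor.
Variable R : realType.
Implicit Types (x : 'cV[R]_8) (h l : bool).

Lemma mdegS n (m : multinom n) d : mdeg m = d.+1 ->
  exists i m', m = mnm_add (mnm1 i) m' /\ mdeg m' = d.
Proof.
move=> md; have [i mi] : exists i, (0 < m i)%N.
  apply/existsP; apply: contraT => /existsPn m0.
  by move: md; rewrite mdegE big1 // => i _; apply/eqP; have := m0 i; rewrite lt0n negbK.
exists i, (mnm_sub m (mnm1 i)).
have mE : m = mnm_add (mnm1 i) (mnm_sub m (mnm1 i)).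
  apply/mnmP => j; rewrite mnmDE mnmBE mnm1E.
  by case: eqVneq => [<-|_]; rewrite ?subnKC.
by split=> //; move: md; rewrite {1}mE mdegD mdeg1 => -[].
Qed.

(** The eight functions z1, ..., z4 and their conjugates, indexed by (c, (h, l))
    with c telling whether to conjugate.  Cubic monomials are indexed by ordered
    triples, hence with repetitions, which is harmless as only spans matter. *)
Definition zindex : finType := (bool * (bool * bool))%type.

Definition zvar (i : zindex) x : R[i] :=
  let z := zc i.2.1 i.2.2 x in if i.1 then conjc z else z.

Lemma ReE (z : R[i]) : (complex.Re z)%:C = 2^-1 * z + 2^-1 * conjc z.
Proof.
have n2 : 2 != 0 :> R[i] by rewrite pnatr_eq0.
rewrite -mulrDr; apply: (mulfI n2); rewrite mulVKf // mulr_natl mulr2n.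
by case: z => a b; rewrite /conjc /=; simpc.
Qed.

Lemma ImE (z : R[i]) : (complex.Im z)%:C = - 'i / 2 * z + 'i / 2 * conjc z.
Proof.
have n2 : 2 != 0 :> R[i] by rewrite pnatr_eq0.
apply: (mulfI n2); rewrite mulr_natl mulr2n mulrDr !mulrA !(mulrC 2) !mulfK //.
by case: z => a b; rewrite /conjc /=; simpc; rewrite addNr.
Qed.

Lemma coord_span (j : 'I_8) : cspan zvar (fun x => (x j 0)%:C).
Proof.
have Re_span h l : cspan zvar (fun x => (complex.Re (zc h l x))%:C).
  apply: cspan_ext (cspanD (cspanZ 2^-1 (cspan_gen zvar (false, (h, l))))
    (cspanZ 2^-1 (cspan_gen zvar (true, (h, l))))) _ => x; exact: ReE.
have Im_span h l : cspan zvar (fun x => (complex.Im (zc h l x))%:C).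
  apply: cspan_ext (cspanD (cspanZ (- 'i / 2) (cspan_gen zvar (false, (h, l))))
    (cspanZ ('i / 2) (cspan_gen zvar (true, (h, l))))) _ => x; exact: ImE.
have coE x : x j 0 = co x j.+1 by rewrite /co /= inord_val.
case: j coE => [[|[|[|[|[|[|[|[|//]]]]]]]] j_lt] coE.
- by apply: cspan_ext (Re_span false false) _ => x; rewrite coE.
- by apply: cspan_ext (Im_span false false) _ => x; rewrite coE.
- by apply: cspan_ext (Re_span false true) _ => x; rewrite coE.
- by apply: cspan_ext (Im_span false true) _ => x; rewrite coE.
- by apply: cspan_ext (Re_span true false) _ => x; rewrite coE.
- by apply: cspan_ext (Im_span true false) _ => x; rewrite coE.
- by apply: cspan_ext (Re_span true true) _ => x; rewrite coE.
- by apply: cspan_ext (Im_span true true) _ => x; rewrite coE.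
Qed.

Definition zmonomial (t : zindex * (zindex * zindex)) x : R[i] :=
  zvar t.1 x * (zvar t.2.1 x * zvar t.2.2 x).

Lemma cubic_span (p : mpoly 8 R) : p \is ishomog1 3 mdeg ->
  cspan zmonomial (fun x => (meval (fun j => x j 0) p)%:C).
Proof.
move=> /dhomogP p3.
apply: cspan_ext (_ : cspan zmonomial (fun x => \sum_(m <- msupp p | m \in msupp p)
  (mcoeff m p)%:C * (meval (fun j => x j 0) (mpolyX R m))%:C)) _; last first.
  move=> x; rewrite mevalE -big_seq rmorph_sum /=; apply: eq_bigr => m _.
  by rewrite mevalX -rmorphM.
apply: cspan_sum => m /p3 m3; apply: cspanZ.
have [i [m' [-> /mdegS [j [m'' [-> /mdegS [k [m0 [-> m0_deg]]]]]]]]] := mdegS m3.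
have /eqP := m0_deg; rewrite mdeg_eq0 => /eqP ->.
apply: cspan_ext (cspanM (coord_span i) (cspanM (coord_span j) (coord_span k))) _ => x.
by rewrite !mpolyXD mpolyX0 !mevalM !mevalXU meval1 mulr1 -!rmorphM.
Qed.

Lemma homog_zc_span P h l : homog_poly_map 3 P ->
  cspan zmonomial (fun x => zc h l (P x)).
Proof.
move=> [p [hp Pp]].
have co_span k : cspan zmonomial (fun x => (co (P x) k)%:C).
  by apply: cspan_ext (cubic_span (hp (inord k.-1))) _ => x; rewrite /co Pp.
have pair_span j k : cspan zmonomial (fun x => co (P x) j +i* co (P x) k).
  apply: cspan_ext (cspanD (co_span j) (cspanZ 'i (co_span k))) _ => x.
  by simpc.
by rewrite /zc; case: h; case: l; apply: pair_span.
Qed.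

End Tensor.

(** * Roots of unity e^(i pi k / n) *)

Section RootsOfUnity.
Variable R : realType.

Lemma cis2pi (k : int) : cis (pi *+ 2 *~ k) = 1 :> R[i].
Proof.
have cis1 : cis (pi *+ 2) = 1 :> R[i] by rewrite /cis cos2pi sin2pi.
case: k => n; first by rewrite -pmulrn cisMn cis1 expr1n.
by rewrite NegzE mulrNz cisN -pmulrn cisMn cis1 expr1n rmorph1.
Qed.

Lemma cis_pi_div_expr (n : nat) (k : int) : (0 < n)%N ->
  cis (pi / n%:R *~ k) ^+ (2 * n) = 1 :> R[i].
Proof.
move=> n_gt0; rewrite -cisMn -[RHS](cis2pi k); congr cis.
have n0 : n%:R != 0 :> R by rewrite pnatr_eq0 -lt0n.
rewrite -(mulrzr (pi / _) k) -(mulrzr (pi *+ 2) k) -[LHS]mulr_natr natrM.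
by rewrite -[pi *+ 2]mulr_natr; field.
Qed.

(** Modulo 2n we may take 0 <= k < 2n; then cos(pi k / n) = 1 forces
    sin(pi k / (2n)) = 0, which happens only for k = 0 in this range. *)
Lemma cis_pi_div_eq1 (n : nat) (k : int) : (0 < n)%N ->
  cis (pi / n%:R *~ k) = 1 :> R[i] -> (2 * n%:Z %| k)%Z.
Proof.
move=> n_gt0; pose d := 2 * n%:Z.
have n0 : n%:R != 0 :> R by rewrite pnatr_eq0 -lt0n.
have d_gt0 : 0 < d by rewrite /d; lia.
rewrite {1}(divz_eq k d) mulrzDr.
have -> : pi / n%:R *~ (divz k d * d) = pi *+ 2 *~ (divz k d) :> R.
  rewrite -(mulrzr (pi / _)) -(mulrzr (pi *+ 2)) /d !intrM.
  by rewrite -[n%:~R]pmulrn -[pi *+ 2]mulr_natr; field.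
rewrite cisD cis2pi mul1r => -[cos1 _].
have r_ge0 : (0 <= modz k d) by rewrite modz_ge0 // gt_eqF.
have r_lt : modz k d < d by rewrite ltz_pmod.
apply/dvdz_mod0P/eqP; apply: contraT => r0.
have r_gt0 : 0 < modz k d by rewrite lt_def r0.
pose s : R := pi / n%:R *~ modz k d / 2.
have s_sin : 0 < sin s.
  have r_ltR : (modz k d)%:~R < 2 * n%:R :> R.
    by move: r_lt; rewrite -(ltr_int R) /d intrM.
  have n2_gt0 : 0 < 2 * n%:R :> R by rewrite mulr_gt0 // ltr0n.
  have -> : s = pi * ((modz k d)%:~R / (2 * n%:R)).
    by rewrite /s -(mulrzr (pi / _)); field.
  apply: sin_gt0_pi; rewrite pmulr_rgt0 ?pi_gt0 // gtr_pMr ?pi_gt0 //.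
  by rewrite divr_gt0 ?ltr0z //= ltr_pdivrMr // mul1r.
have := cos_mulr2n s.
have -> : s *+ 2 = pi / n%:R *~ modz k d by rewrite -[LHS]mulr_natr divfK.
move: cos1 => /= ->; rewrite cos2sin2 => c1.
have : sin s ^+ 2 = 0 by lra.
by move/eqP; rewrite sqrf_eq0 gt_eqF.
Qed.

End RootsOfUnity.

(** * The monomials of the first component of a cubic equivariant *)

Section Support.
Variable R : realType.
Implicit Types (x : 'cV[R]_8) (h l : bool).

Definition conj_sign (c : bool) : int := if c then -1 else 1.

(** Weights of the eight functions: C acts on [zvar i] with exponent
    wt_low + rho wt_high in units of pi / a, and D(pi/b) with exponent wtD in
    units of pi / b. *)
Definition wt_low (i : zindex) : int := if i.2.1 then 0 else conj_sign i.1.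
Definition wt_high (i : zindex) : int := if i.2.1 then conj_sign i.1 else 0.
Definition wtD (i : zindex) : int := if i.2.2 then conj_sign i.1 else - conj_sign i.1.
Definition total (wt : zindex -> int) (t : zindex * (zindex * zindex)) : int :=
  wt t.1 + (wt t.2.1 + wt t.2.2).

Lemma zvar_C a rho i x : zvar i (C_mx R a rho *m x) =
  cis (pi / a%:R *~ (wt_low i + rho%:Z * wt_high i)) * zvar i x.
Proof.
case: i => -[] [h l]; rewrite /zvar /= zc_C /wt_low /wt_high /=;
  case: h => /=; rewrite ?rmorphM /= ?mulr0 ?addr0 ?add0r ?mulr1 ?mulrN1 ?mulrNz ?cisN //.
Qed.

Lemma zvar_D (b : nat) i x : zvar i (D_mx (pi / b%:R) *m x) =
  cis (pi / b%:R *~ wtD i) * zvar i x.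
Proof.
case: i => -[] [h l]; rewrite /zvar /= zc_D /wtD /=;
  case: l => /=; rewrite ?rmorphM /= ?opprK ?mulrNz ?cisN ?conjcK //.
Qed.

Lemma zmonomial_C a rho t x : zmonomial t (C_mx R a rho *m x) =
  cis (pi / a%:R *~ (total wt_low t + rho%:Z * total wt_high t)) * zmonomial t x.
Proof.
have -> : total wt_low t + rho%:Z * total wt_high t =
  (wt_low t.1 + rho%:Z * wt_high t.1) + ((wt_low t.2.1 + rho%:Z * wt_high t.2.1)
    + (wt_low t.2.2 + rho%:Z * wt_high t.2.2)) by rewrite /total; ring.
rewrite /zmonomial !zvar_C.
move: (wt_low t.1 + _) (wt_low t.2.1 + _) (wt_low t.2.2 + _) => p q r.
by rewrite !mulrzDr !cisD; ring.
Qed.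

Lemma zmonomial_D b t x : zmonomial t (D_mx (pi / b%:R) *m x) =
  cis (pi / b%:R *~ total wtD t) * zmonomial t x.
Proof. by rewrite /zmonomial !zvar_D /total !mulrzDr !cisD; ring. Qed.

Lemma total_wt_C t : (absz (total wt_low t) + absz (total wt_high t) <= 3)%N /\
  odd (absz (total wt_low t) + absz (total wt_high t)).
Proof.
have unit_wt i : wt_high i = 0 /\ (wt_low i = 1 \/ wt_low i = -1) \/
    wt_low i = 0 /\ (wt_high i = 1 \/ wt_high i = -1).
  by case: i => -[] [[] ?]; rewrite /wt_low /wt_high /=; tauto.
rewrite /total; move: (unit_wt t.1) (unit_wt t.2.1) (unit_wt t.2.2).
by move=> [[-> [->|->]]|[-> [->|->]]] [[-> [->|->]]|[-> [->|->]]] [[-> [->|->]]|[-> [->|->]]].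
Qed.

Lemma total_wtD t : (absz (total wtD t) <= 3)%N /\ odd (absz (total wtD t)).
Proof.
have unit_wt i : wtD i = 1 \/ wtD i = -1.
  by case: i => -[] [? []]; rewrite /wtD /=; tauto.
rewrite /total; move: (unit_wt t.1) (unit_wt t.2.1) (unit_wt t.2.2).
by move=> [->|->] [->|->] [->|->].
Qed.

Definition E_zc1 (i : 'I_5) x : R[i] := zc false false (E_cubic R i x).

(** Of the 512 triples, only the reorderings of z1 |z_j|^2 and of
    z2 z3 conj(z4) have these weights. *)
Lemma resonant_span t : total wt_low t = 1 -> total wt_high t = 0 -> total wtD t = -1 ->
  cspan E_zc1 (zmonomial t).
Proof.
pose z1 x := zc false false x; pose z2 x := zc false true x.
pose z3 x := zc true false x; pose z4 x := zc true true x.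
have s1 : cspan E_zc1 (fun x => z1 x * conjc (z1 x) * z1 x).
  by apply: cspan_ext (cspan_gen E_zc1 (@Ordinal 5 0 isT)) _ => x; rewrite [RHS]zc_E1.
have s2 : cspan E_zc1 (fun x => z2 x * conjc (z2 x) * z1 x).
  by apply: cspan_ext (cspan_gen E_zc1 (@Ordinal 5 1 isT)) _ => x; rewrite [RHS]zc_E2.
have s3 : cspan E_zc1 (fun x => z3 x * conjc (z3 x) * z1 x).
  by apply: cspan_ext (cspan_gen E_zc1 (@Ordinal 5 2 isT)) _ => x; rewrite [RHS]zc_E3.
have s4 : cspan E_zc1 (fun x => z4 x * conjc (z4 x) * z1 x).
  by apply: cspan_ext (cspan_gen E_zc1 (@Ordinal 5 3 isT)) _ => x; rewrite [RHS]zc_E4.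
have s5 : cspan E_zc1 (fun x => z2 x * z3 x * conjc (z4 x)).
  apply: cspan_ext (cspanZ (-1) (cspan_gen E_zc1 (@Ordinal 5 4 isT))) _ => x.
  by rewrite [E_zc1 _ _]zc_E5 mulN1r opprK.
case: t => -[[] [[] []]] [[[] [[] []]] [[] [[] []]]] // _ _ _;
  first [ apply: cspan_ext s1 _ => x; rewrite /zmonomial /zvar /z1 /=; ring
        | apply: cspan_ext s2 _ => x; rewrite /zmonomial /zvar /z1 /z2 /=; ring
        | apply: cspan_ext s3 _ => x; rewrite /zmonomial /zvar /z1 /z3 /=; ring
        | apply: cspan_ext s4 _ => x; rewrite /zmonomial /zvar /z1 /z4 /=; ring
        | apply: cspan_ext s5 _ => x; rewrite /zmonomial /zvar /z2 /z3 /z4 /=; ring ].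
Qed.

Lemma cubic_zc1_span (a rho b : nat) (P : 'cV[R]_8 -> 'cV[R]_8) :
  in_bbA a -> (5 < a)%N -> (rho%:Z ^+ 2 = -1 %[mod a%:Z])%Z -> (3 <= b)%N ->
  PG (G_ab R a rho b) 3 P -> cspan E_zc1 (fun x => zc false false (P x)).
Proof.
move=> a_A a_gt rho2 b_ge [P_homog P_eq].
have a_gt0 : (0 < a)%N by apply: leq_trans a_gt.
have b_gt0 : (0 < b)%N by apply: leq_trans b_ge.
pose F x := zc false false (P x).
have [c Fc] : cspan (@zmonomial R) F by apply: homog_zc_span.
pose lamC t : R[i] := cis (pi / a%:R *~ (total wt_low t + rho%:Z * total wt_high t)).
pose lamD t : R[i] := cis (pi / b%:R *~ total wtD t).
have FC x : F (C_mx R a rho *m x) = cis (pi / a%:R *~ 1) * F x.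
  rewrite /F P_eq ?zc_C //; apply: generated_sub.
  by do 4!left.
have FD x : F (D_mx (pi / b%:R) *m x) = cis (pi / b%:R *~ -1) * F x.
  rewrite /F P_eq ?zc_D ?mulrNz //; apply: generated_sub.
  by do 3!left; right.
have Fc1 : forall x, F x =
    \sum_(t | true && (lamC t == cis (pi / a%:R *~ 1))) c t * zmonomial t x.
  apply: (@eigen_filter _ _ _ xpredT _ _ _ _ _ _ (2 * a)) FC Fc.
  - by rewrite muln_gt0.
  - exact: cis_neq0.
  - by move=> t; rewrite !cis_pi_div_expr.
  - by move=> t x; apply: zmonomial_C.
have Fc2 : forall x, F x = \sum_(t | (true && (lamC t == cis (pi / a%:R *~ 1)))
    && (lamD t == cis (pi / b%:R *~ -1))) c t * zmonomial t x.
  apply: (@eigen_filter _ _ _ (fun t => true && (lamC t == _)) _ _ _ _ _ _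
    (2 * b)) FD Fc1.
  - by rewrite muln_gt0.
  - exact: cis_neq0.
  - by move=> t; rewrite !cis_pi_div_expr.
  - by move=> t x; apply: zmonomial_D.
apply: cspan_ext Fc2; apply: cspan_sum => t /andP[/= /eqP tC /eqP tD].
apply: cspanZ.
have cis_eq (n : nat) j k : (0 < n)%N ->
    cis (pi / n%:R *~ j) = cis (pi / n%:R *~ k) :> R[i] -> (2 * n%:Z %| j - k)%Z.
  move=> n_gt0 jk; apply: (@cis_pi_div_eq1 R) => //.
  by rewrite mulrzBr cisD jk cisN cis_conjK.
have [wt12_le wt12_odd] := total_wt_C t; have [wtD_le wtD_odd] := total_wtD t.
have [t1 t2] : total wt_low t = 1 /\ total wt_high t = 0.
  apply: (@resonance_C a rho) => //; first exact: in_bbA_mod4.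
  by apply: dvdz_trans (cis_eq a _ _ a_gt0 tC); apply: dvdz_mull.
apply: resonant_span => //; apply: (@resonance_D b) => //.
by rewrite -[1]opprK; apply: cis_eq.
Qed.

End Support.

(** * The basis of cubic equivariants *)

Section Basis.
Variable R : realType.
Implicit Types (x : 'cV[R]_8) (h l : bool).

Lemma Q_in_G_ab a rho b : G_ab R a rho b (Q_mx R).
Proof. by apply: generated_sub; do 2!left; right. Qed.
Lemma S_in_G_ab a rho b : G_ab R a rho b (S_mx R).
Proof. by apply: generated_sub; left; right. Qed.
Lemma V_in_G_ab a rho b : G_ab R a rho b (V_mx R).
Proof. by apply: generated_sub; right. Qed.

(** Q exchanges z1 and z2 up to sign, and the coordinates z1, z2 of V x are
    z3, z4 of x, so the z2-component of an equivariant map determines the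
    others. *)
Lemma equivariant_eq a rho b (P P' : 'cV[R]_8 -> 'cV[R]_8) :
  equivariant (G_ab R a rho b) P -> equivariant (G_ab R a rho b) P' ->
  (forall x, zc false true (P x) = zc false true (P' x)) -> P = P'.
Proof.
move=> eP eP' PP'.
have PP'1 x : zc false false (P x) = zc false false (P' x).
  have toQ M : zc false false M = - zc false true (Q_mx R *m M).
    by rewrite zc_Q expr1 mulN1r opprK.
  by rewrite !toQ -(eP _ (@Q_in_G_ab a rho b)) -(eP' _ (@Q_in_G_ab a rho b)) PP'.
have PP'2 h l x : zc h l (P x) = zc h l (P' x).
  have PP'0 l' y : zc false l' (P y) = zc false l' (P' y) by case: l'.
  case: h => //.
  have toV M : zc true l M = zc false l (V_mx R *m M) by rewrite zc_V.
  by rewrite !toV -(eP _ (@V_in_G_ab a rho b)) -(eP' _ (@V_in_G_ab a rho b)) PP'0.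
by apply/funext => x; apply: zc_inj => h l.
Qed.

Lemma E_cubic_PG a rho b i : PG (G_ab R a rho b) 3 (E_cubic R i).
Proof.
split; first exact: E_cubic_homog.
by move=> g /G_ab_sub_bold; apply: E_cubic_equivariant.
Qed.

Lemma comb_equivariant (G : set 'M[R]_8) (k : 'I_5 -> R) :
  (forall i, equivariant G (E_cubic R i)) ->
  equivariant G (\sum_i k i *: E_cubic R i).
Proof.
move=> EG g Gg x; rewrite !fct_sumE mulmx_sumr; apply: eq_bigr => i _.
by rewrite !fctE /= EG // scalemxAr.
Qed.

Lemma zc_comb h l (k : 'I_5 -> R) x :
  zc h l ((\sum_i k i *: E_cubic R i) x) = \sum_i (k i)%:C * zc h l (E_cubic R i x).
Proof.
rewrite fct_sumE (big_morph _ (zcD h l) (zc0 R h l)).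
by apply: eq_bigr => i _; rewrite !fctE zcZ.
Qed.

(** The complex coefficients c_k found on the z1-component may be replaced by
    their real parts: transport to z2 by Q keeps the c_k, transport by S
    conjugates them, and the mean of the two expressions is real. *)
Lemma E_cubic_span a rho b P :
  in_bbA a -> (5 < a)%N -> (rho%:Z ^+ 2 = -1 %[mod a%:Z])%Z -> (3 <= b)%N ->
  PG (G_ab R a rho b) 3 P ->
  exists k : 'I_5 -> R, P = \sum_i k i *: E_cubic R i.
Proof.
move=> a_A a_gt rho2 b_ge PGP; have [_ eP] := PGP.
have [c Pc] := cubic_zc1_span a_A a_gt rho2 b_ge PGP.
have eE i : equivariant (G_ab R a rho b) (E_cubic R i) by case: (E_cubic_PG a rho b i).
have z2_c x : zc false true (P x) = \sum_i c i * zc false true (E_cubic R i x).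
  have toQ M : zc false true M = zc false false (Q_mx R *m M) by rewrite zc_Q mul1r.
  rewrite toQ -(eP _ (@Q_in_G_ab a rho b)) Pc; apply: eq_bigr => i _.
  by rewrite toQ -(eE i _ (@Q_in_G_ab a rho b)).
have z2_conj x : zc false true (P x) = \sum_i conjc (c i) * zc false true (E_cubic R i x).
  have toS M : zc false true M = - conjc (zc false false (S_mx R *m M)).
    by rewrite zc_S expr1 mulN1r rmorphN /= conjcK opprK.
  rewrite toS -(eP _ (@S_in_G_ab a rho b)) Pc rmorph_sum -sumrN; apply: eq_bigr => i _.
  by rewrite rmorphM /= -mulrN; congr (_ * _); rewrite toS -(eE i _ (@S_in_G_ab a rho b)).
exists (fun i => complex.Re (c i)).
apply: (equivariant_eq eP) => [|x]; first exact: comb_equivariant.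
rewrite zc_comb.
have n2 : 2 != 0 :> R[i] by rewrite pnatr_eq0.
transitivity (2^-1 * zc false true (P x) + 2^-1 * zc false true (P x)).
  by rewrite -mulrDr; apply: (mulfI n2); rewrite mulVKf // mulr_natl mulr2n.
rewrite {1}z2_c z2_conj !mulr_sumr -big_split; apply: eq_bigr => i _ /=.
by rewrite ReE; ring.
Qed.

(** The first coordinates of E_1, ..., E_5 at the points e1, e1 + e3, e1 + e5,
    e1 + e7 and e3 + e5 + e7 form an invertible triangular system. *)
Lemma E_cubic_free (k : 'I_5 -> R) : \sum_i k i *: E_cubic R i = 0 -> forall i, k i = 0.
Proof.
move=> k0.
have at_pt (s : seq R) : \sum_i k i * co (E_cubic R i (vec8 s)) 1 = 0.
  have /(congr1 (fun P : 'cV[R]_8 -> 'cV[R]_8 => co (P (vec8 s)) 1)) := k0.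
  rewrite /co fct_sumE summxE [X in _ = X]mxE => k0s; rewrite -[RHS]k0s.
  by apply: eq_bigr => i _; rewrite !fctE [RHS]mxE.
have evE s : k (@Ordinal 5 0 isT) * co (E1 (vec8 s)) 1
  + k (@Ordinal 5 1 isT) * co (E2 (vec8 s)) 1
  + k (@Ordinal 5 2 isT) * co (E3 (vec8 s)) 1
  + k (@Ordinal 5 3 isT) * co (E4 (vec8 s)) 1
  + k (@Ordinal 5 4 isT) * co (E5 (vec8 s)) 1 = 0.
  rewrite -[RHS](at_pt s) !big_ord_recl big_ord0 addr0 !addrA.
  by do ![congr (_ + _)]; congr (k _ * _); exact: val_inj.
have := evE [:: 1]; have := evE [:: 1; 0; 1]; have := evE [:: 1; 0; 0; 0; 1].
have := evE [:: 1; 0; 0; 0; 0; 0; 1]; have := evE [:: 0; 0; 1; 0; 1; 0; 1].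
rewrite /E1 /E2 /E3 /E4 /E5 !co_vec8 // /n1 /n2 /n3 /n4 !co_vec8 //=.
move=> e5 e4 e3 e2 e1 [[|[|[|[|[|//]]]]] i_lt];
  match goal with |- k (@Ordinal _ ?n _) = 0 =>
    have -> : @Ordinal 5 n i_lt = @Ordinal 5 n isT by exact: val_inj end;
  lra.
Qed.

Lemma zcN h l x : zc h l (- x) = - zc h l x.
Proof. by rewrite -scaleN1r zcZ rmorphN1 mulN1r. Qed.

Lemma iter_D_pi_div (b : nat) x : (0 < b)%N ->
  iter b (mulmx (D_mx (pi / b%:R))) x = - x.
Proof.
move=> b_gt0; have b0 : b%:R != 0 :> R by rewrite pnatr_eq0 -lt0n.
have iterE n h l : zc h l (iter n (mulmx (D_mx (pi / b%:R))) x) =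
    cis (if l then pi / b%:R else - (pi / b%:R)) ^+ n * zc h l x.
  by elim: n => [|n IH]; rewrite ?mul1r //= zc_D IH exprS mulrA.
apply: zc_inj => h l; rewrite iterE zcN -cisMn.
have cispi : cis pi = -1 :> R[i].
  by rewrite /cis cospi sinpi; apply/eqP; rewrite eq_complex /= oppr0 !eqxx.
have -> : (if l then pi / b%:R else - (pi / b%:R)) *+ b = if l then pi else - pi :> R.
  by rewrite -[LHS]mulr_natr; case: l; rewrite ?mulNr divfK.
by case: l; rewrite ?cisN cispi ?rmorphN ?rmorph1 mulN1r.
Qed.

Lemma homog_poly_mapN d (P : 'cV[R]_8 -> 'cV[R]_8) x :
  homog_poly_map d P -> P (- x) = (-1) ^+ d *: P x.
Proof.
move=> [p [hp Pp]]; apply/colP => i; rewrite [RHS]mxE !Pp !mevalE mulr_sumr.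
have /dhomogP pd := hp i.
rewrite [LHS]big_seq [RHS]big_seq; apply: eq_bigr => m /pd md; rewrite mulrCA.
congr (_ * _); transitivity (\prod_j ((-1) ^+ m j * x j 0 ^+ m j)).
  by apply: eq_bigr => j _; rewrite mxE -exprMn mulN1r.
rewrite big_split /= -(big_morph _ (exprD (-1)) (expr0 (-1))).
by move: md; rewrite /= mdegE => ->.
Qed.

(** D(pi/b)^b = -1, so a quadratic equivariant is odd; it is even by
    homogeneity. *)
Lemma PG2_eq0 a rho b : odd b -> PG (G_ab R a rho b) 2 = [set 0].
Proof.
move=> b_odd; apply/seteqP; split=> [P [P_homog P_eq]|P ->]; 
  last by case: (PG_submod (G_ab R a rho b) 2).
apply/funext => x.
have iterP n : P (iter n (mulmx (D_mx (pi / b%:R))) x) =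
    iter n (mulmx (D_mx (pi / b%:R))) (P x).
  elim: n => //= n <-; rewrite P_eq //.
  by apply: generated_sub; do 3!left; right.
have := iterP b; rewrite !iter_D_pi_div ?odd_gt0 //.
rewrite (homog_poly_mapN _ P_homog) expr2 mulrNN mulr1 scale1r => PN.
by apply/colP => i; have := congr1 (fun v : 'cV[R]_8 => v i 0) PN; rewrite !mxE; lra.
Qed.

End Basis.

Theorem theorem1p7 (R : realType) (a rho b : nat)
    (a_A : in_bbA a)
    (rho_odd : odd rho)
    (rho_lt : (rho < a)%N)
    (rho_sqr : (rho%:Z ^+ 2 = -1 %[mod a%:Z])%Z)
    (a_gt5 : (5 < a)%N)
    (b_odd : odd b)
    (b_neq1 : b <> 1%N)
    (ab_coprime : coprime a b) :
  [/\ PG (G_ab R a rho b) 2 = [set 0],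
      has_dim (PG (G_ab R a rho b) 3) 5,
      is_basis (PG (G_ab R a rho b) 3) (E_cubic R)
    & forall i : 'I_5, equivariant (bold_G R a rho) (E_cubic R i)].
Proof.
have b_ge3 : (3 <= b)%N by case: b b_odd b_neq1 {ab_coprime} => [|[|[|]]].
have E_basis : is_basis (PG (G_ab R a rho b) 3) (E_cubic R).
  split; [exact: E_cubic_PG|exact: E_cubic_free|] => P.
  exact: E_cubic_span.
split=> //; first exact: PG2_eq0.
- by exists (E_cubic R).
- exact: E_cubic_equivariant.
Qed.
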